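(* Let $w\in A_\infty$ be a weight on $\mathbb R^d$ and let $Q_0\subset\mathbb R^d$ be a cube. Then $$\frac1{|Q_0|}\int_{Q_0}w^{1+\varepsilon}\,dx\le 2\left(\frac1{|Q_0|}\int_{Q_0}w\,dx\right)^{1+\varepsilon}$$ for every $\varepsilon$ with $$0<\varepsilon\le\frac1{2^{d+1}[w]_{A_\infty}-1}.$$
   Context: Cubes are cubes in $\mathbb R^d$ with edges parallel to the coordinate axes, and $|Q|$ is Lebesgue measure. A weight is a nonnegative, locally integrable function $w$ (not a.e. zero) on $\mathbb R^d$, and $w(Q)=\int_Q w\,dx$. The $A_\infty$ constant is $$[w]_{A_\infty}:=\sup_Q\frac1{w(Q)}\int_Q M(w\chi_Q)\,dx,$$ where the supremum is over all cubes $Q$ (with $w(Q)>0$) and $Mf(x)=\sup_{Q\ni x}\frac1{|Q|}\int_Q|f|\,dy$ is the uncentered Hardy-Littlewood maximal function over cubes. One says $w\in A_\infty$ if $[w]_{A_\infty}<\infty$. *)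

(* Defs.v *)
From HB Require Import structures.
From mathcomp Require Import all_boot all_order all_algebra.
From mathcomp Require Import all_classical all_reals all_analysis.
From mathcomp Require Import measurable_realfun.
Set Implicit Arguments.
Unset Strict Implicit.
Unset Printing Implicit Defensive.
Import Order.TTheory GRing.Theory Num.Theory.
Import numFieldNormedType.Exports.
Local Open Scope classical_set_scope.
Local Open Scope ring_scope.

(** * Lebesgue measure on R^d

    The library has Lebesgue measure on the line only. On R^d it is obtained
    here by applying the library's Caratheodory construction to the outer
    measure [X |-> inf { sum_k vol(B_k) | X `<=` \bigcup_k B_k, B_k boxes }].
    The resulting measurable sets are the Lebesgue (not just Borel) measurable
    ones. *)
Section lebesgue_Rd.
Context {R : realType} {d : nat}.
Local Open Scope ereal_scope.

(* [Some (a, b)] is the closed box with opposite corners [a] and [b];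
   [None] is the empty set, so that sequences of boxes cover finite families
   too (the padding matters only for d = 0, where no box is null). *)
Definition box (B : option ('rV[R]_d * 'rV[R]_d)) : set 'rV[R]_d :=
  if B is Some (a, b) then [set x | forall i, (a 0 i <= x 0 i <= b 0 i)%R]
  else set0.

Definition box_vol (B : option ('rV[R]_d * 'rV[R]_d)) : \bar R :=
  if B is Some (a, b) then (\prod_(i < d) Num.max 0 (b 0 i - a 0 i))%R%:E
  else 0.

Definition box_cover (X : set 'rV[R]_d) :
    set (option ('rV[R]_d * 'rV[R]_d))^nat :=
  [set B | X `<=` \bigcup_k box (B k)].

Definition lebesgue_outer (X : set 'rV[R]_d) : \bar R :=
  ereal_inf [set \sum_(k <oo) box_vol (B k) | B in box_cover X].

Lemma box_vol_ge0 B : 0 <= box_vol B.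
Proof.
case: B => [[a b]|] //=; rewrite lee_fin; apply: prodr_ge0 => i _.
by rewrite le_max lexx.
Qed.

Lemma lebesgue_outer_ge0 X : 0 <= lebesgue_outer X.
Proof.
apply: le_ereal_inf_tmp => x [B _ <-{x}]; apply: nneseries_ge0 => n _ _.
exact: box_vol_ge0.
Qed.

Lemma lebesgue_outer0 : lebesgue_outer set0 = 0.
Proof.
apply/eqP; rewrite eq_le lebesgue_outer_ge0 andbT.
apply: ereal_inf_lbound; exists (fun=> None); first by move=> x.
by rewrite eseries0.
Qed.

Lemma le_lebesgue_outer :
  {homo lebesgue_outer : A B / A `<=` B >-> A <= B}.
Proof.
move=> A B AB; apply/ereal_inf_le_tmp => x [C BC <-{x}].
by exists C => //; exact: subset_trans AB BC.
Qed.

Lemma lebesgue_outer_sigma_subadditive : sigma_subadditive lebesgue_outer.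
Proof.
move=> A; have [[i ioo]|] := pselect (exists i, lebesgue_outer (A i) = +oo).
  rewrite (eseries_pinfty _ _ ioo) ?leey// => n _.
  by rewrite -ltNye (lt_le_trans _ (lebesgue_outer_ge0 _)).
rewrite -forallNE => Aoo.
suff add2e (e : {posnum R}) : lebesgue_outer (\bigcup_n A n) <=
    \sum_(i <oo) lebesgue_outer (A i) + e%:num%:E.
  by apply/lee_addgt0Pr => _/posnumP[].
rewrite (le_trans _ (epsilon_trick _ _ _))//; last first.
  by move=> n; exact: lebesgue_outer_ge0.
pose P n B := box_cover (A n) B /\ \sum_(k <oo) box_vol (B k) <=
  lebesgue_outer (A n) + (e%:num / (2 ^ n.+1)%:R)%:E.
have [G PG] : {G & forall n, P n (G n)}.
  apply: (@choice _ _ P) => n; rewrite /P /lebesgue_outer.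
  set S := (X in ereal_inf X); move infS : (ereal_inf S) => iS.
  case: iS infS => [r Sr|Soo|Soo].
  - have en1 : (0 < e%:num / (2 ^ n.+1)%:R)%R by [].
    have /(lb_ereal_inf_adherent en1) : ereal_inf S \is a fin_num by rewrite Sr.
    move=> [x [B AnB muBx] xS].
    by exists B; split => //; rewrite muBx -Sr; exact/ltW.
  - by have := Aoo n; rewrite /lebesgue_outer Soo.
  - by have := lebesgue_outer_ge0 (A n); rewrite /lebesgue_outer Soo.
have volG_ge0 x : 0 <= (box_vol \o uncurry G) x by exact: box_vol_ge0.
apply: (@le_trans _ _ (\esum_(i in setT) (box_vol \o uncurry G) i)).
  apply: ereal_inf_lbound => /=.
  have /card_esym/ppcard_eqP[f] := card_nat2.
  exists (uncurry G \o f).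
    apply: (@subset_trans _ (\bigcup_n \bigcup_k box (G n k))) => [t [i _]|].
      by move=> /(PG i).1 -[j _ ?]; exists i => //; exists j.
    move=> t [i _ [j _ Bijt]]; exists (f^-1%FUN (i, j)) => //=.
    by rewrite invK ?inE.
  rewrite -(esum_pred_image (box_vol \o uncurry G) _ xpredT) ?[fun=> _]set_true//.
  by rewrite image_eq.
rewrite (_ : esum _ _ = \sum_(i <oo) \sum_(j <oo) box_vol (G i j)); last first.
  pose J : nat -> set (nat * nat) := fun i => [set (i, j) | j in setT].
  rewrite (_ : setT = \bigcup_k J k); last first.
    by rewrite predeqE => -[a b]; split => // _; exists a => //; exists b.
  rewrite esum_bigcupT /=; last 2 first.
  - apply/trivIsetP => i j _ _ ij.
    rewrite predeqE => -[n m] /=; split => //= -[] [_] _ [<-{n} _].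
    by move=> [m' _] [] /esym/eqP; rewrite (negbTE ij).
  - exact: volG_ge0.
  rewrite -(image_id [set: nat]) -fun_true esum_pred_image//; last first.
    by move=> n _; apply: esum_ge0 => x _; exact: volG_ge0.
  apply: eq_eseriesr => /= j _.
  rewrite -(esum_pred_image (box_vol \o uncurry G) (pair j) predT)/=; last 2 first.
  - by move=> n _; exact: box_vol_ge0.
  - by move=> ? ? _ _; exact: (@can_inj _ _ _ snd).
  by congr esum; rewrite predeqE => -[a b]; split; move=> [i _ <-]; exists i.
apply: lee_nneseries => [n _ _|n _]; last exact: (PG n).2.
by apply: nneseries_ge0 => m *; exact: (volG_ge0 (n, m)).
Qed.

HB.instance Definition _ := isOuterMeasure.Build R 'rV[R]_d lebesgue_outer
  lebesgue_outer0 lebesgue_outer_ge0 le_lebesgue_outer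
  lebesgue_outer_sigma_subadditive.

End lebesgue_Rd.

(* R^d as a measurable space (convertible to ['rV[R]_d]). *)
Definition Rd (R : realType) (d : nat) :=
  caratheodory_type (@lebesgue_outer R d).

HB.instance Definition _ (R : realType) (d : nat) :=
  Measurable.copy (Rd R d) (caratheodory_type (@lebesgue_outer R d)).

Definition leb {R : realType} {d : nat} : set (Rd R d) -> \bar R :=
  @lebesgue_outer R d.

HB.instance Definition _ (R : realType) (d : nat) :=
  isMeasure.Build _ (Rd R d) R (@leb R d)
    (caratheodory_measure0 (@lebesgue_outer R d))
    (caratheodory_measure_ge0 (mu := @lebesgue_outer R d))
    (caratheodory_measure_sigma_additive (mu := @lebesgue_outer R d)).

Section weights.
Context {R : realType} {d : nat}.
Implicit Types (Q : set (Rd R d)) (w f : Rd R d -> R).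
Local Open Scope ereal_scope.

(* Closed cubes with lower corner [a] and side length [l]. *)
Definition cube (a : 'rV[R]_d) (l : R) : set (Rd R d) :=
  [set x : 'rV[R]_d | forall i, (a 0 i <= x 0 i <= a 0 i + l)%R].

Definition is_cube Q := exists a l, (0 < l)%R /\ Q = cube a l.

(* [measurable_fun] is Lebesgue measurability on [Rd], while [compact] refers to
   the usual topology of ['rV[R]_d]. *)
Definition weight w := [/\ forall x, (0 <= w x)%R,
  measurable_fun setT w,
  forall K : set 'rV[R]_d, compact K -> \int[leb]_(x in K) `|w x|%:E < +oo &
  ~ {ae leb, forall x, w x = 0%R}].

Definition avg f Q : \bar R := (leb Q)^-1 * \int[leb]_(x in Q) (f x)%:E.

Definition maximal f (x : Rd R d) : \bar R :=
  ereal_sup [set avg (fun y => `|f y|%R) Q | Q in [set Q | is_cube Q /\ Q x]].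

Definition wmeas w Q : \bar R := \int[leb]_(x in Q) (w x)%:E.

Definition Ainfty_const w : \bar R :=
  ereal_sup [set (wmeas w Q)^-1 *
                 \int[leb]_(x in Q) maximal (fun y => w y * \1_Q y)%R x
            | Q in [set Q | is_cube Q /\ 0 < wmeas w Q]].

Definition Ainfty w := weight w /\ Ainfty_const w < +oo.

End weights.

(* Main.v *)
Require Import Defs.
From HB Require Import structures.
From mathcomp Require Import all_boot all_order all_algebra.
From mathcomp Require Import all_classical all_reals all_analysis.
From mathcomp Require Import measurable_realfun.
From mathcomp Require Import ring lra.
Set Implicit Arguments.
Unset Strict Implicit.
Unset Printing Implicit Defensive.
Import Order.TTheory GRing.Theory Num.Theory.
Import numFieldNormedType.Exports.
Local Open Scope classical_set_scope.
Local Open Scope ring_scope.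

(** Write [w(Q)] for the integral of [w] over [Q], [A] for the [A_infinity]
    constant, and cut [Q0] dyadically.  Let [M_n] be the largest average of [w]
    over the dyadic subcubes of [Q0] of generation at most [n] that contain the
    given point.  The whole argument concerns the two finite sums
<<
      S = \int_Q0 M_n^eps w    and    T = \int_Q0 M_n^(1+eps).
>>
    Both are obtained by letting [M_k] grow one generation at a time.  It grows
    only on the cubes [Q] whose average exceeds the average over all their
    dyadic ancestors, and on such a [Q] two things happen.
    - The average over [Q] is at most [2^d] times the previous value of the
      maximal function, because the average over the parent was already counted.
      With Young's inequality ([young_increment]) this bounds the growth of [S]
      by [2^d eps / (1 + eps)] times the growth of [T]
      ([leaf_sum_weight_le]).
    - From [Q] on, [M_n] no longer remembers what lies outside [Q], so that it
      is at most [M(w 1_Q)] on [Q] and its integral over [Q] is at most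
      [A w(Q)].  Summing by parts, [T <= A S] ([leaf_sum_volume_le]).
    As [2^(d+1) A eps <= 1 + eps], combining the two gives
    [S <= <w>^eps w(Q0) + S / 2], where [<w>] is the average over [Q0]; since
    [S] is a finite sum it can be absorbed, and [S <= 2 <w>^eps w(Q0)]
    ([leaf_sum_reverse_holder]).  No integral over level sets occurs.

    It remains to let [n] tend to infinity, which needs [w <= sup_n M_n] almost
    everywhere ([ae_le_dyadic_max]).  This follows from the definition of
    Lebesgue measure by coverings.  Let [E] be a set where all [M_n] are at most
    [r], and cover it by boxes.  The dyadic cubes of a fine generation that meet
    [E] inside a box lie in a slight enlargement of that box, and the average of
    [w] over each of them is at most [r]; hence [w(E) <= r |E|]
    ([weak_type]).  If [w >= q > r] on [E], then [E] is null.

    The volume of a cube is never computed.  Translation invariance, which makes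
    the [2^d] children of a cube equally large, is enough, and a cube of volume
    zero carries no mass. *)

(** * The reverse Hoelder inequality on a finite tree *)

Section stopping_tree.
Context {R : realType}.
Implicit Types (a b e s t : R).

Lemma powR_split e t : 0 < e -> 0 <= t -> t `^ (1 + e) = t * t `^ e.
Proof.
move=> e0 t0; rewrite -(mulr_powRB1 (p := 1 + e)) ?addr_gt0//.
by rewrite addrAC subrr add0r.
Qed.

Lemma le_powRl e : 0 < e ->
  {in Num.nneg &, {homo (fun t => t `^ e) : s t / s <= t}}.
Proof. by move=> e0; exact/ge0_ler_powR/ltW. Qed.

(** Replacing the last factor [b] by [a] costs a factor [K], since [b <= K a].
    What is left is [b^e a <= e/(1+e) b^(1+e) + 1/(1+e) a^(1+e)], an instance of
    Young's inequality. *)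
Lemma young_increment e K a b : 0 < e -> 0 <= a -> a <= b -> b <= K * a ->
  (b `^ e - a `^ e) * b <= K * (e / (1 + e)) * (b `^ (1 + e) - a `^ (1 + e)).
Proof.
move=> e0 a0 ab bK; have b0 : 0 <= b by exact: le_trans ab.
have e1 : 0 < 1 + e by rewrite addr_gt0.
have incr : 0 <= b `^ e - a `^ e by rewrite subr_ge0 le_powRl// nnegrE.
have young : (b `^ e - a `^ e) * a <= e / (1 + e) * (b `^ (1 + e) - a `^ (1 + e)).
  have conj : ((1 + e) / e)^-1 + (1 + e)^-1 = 1.
    by field; rewrite !gt_eqF.
  have := conjugate_powR (powR_ge0 b e) a0 (divr_gt0 e1 e0) e1 conj.
  rewrite -powRrM [e * _]mulrC divfK ?gt_eqF//.
  rewrite (powR_split e0 a0) (powR_split e0 b0) => h.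
  rewrite -subr_ge0 in h; rewrite -subr_ge0.
  rewrite (_ : _ - _ = (b * b `^ e) / ((1 + e) / e) + a * a `^ e / (1 + e)
    - b `^ e * a)//.
  by field; rewrite !gt_eqF.
have [aK|aK] := leP a 0.
  have a00 : a = 0 by apply/le_anti; rewrite aK a0.
  have b00 : b = 0 by apply/le_anti; rewrite b0 (le_trans bK)// a00 mulr0.
  by rewrite a00 b00 !subrr mul0r mulr0.
have K0 : 0 <= K by rewrite -(pmulr_lge0 _ aK) (le_trans _ bK).
rewrite -mulrA; apply: le_trans (ler_wpM2l K0 young).
by rewrite mulrCA ler_wpM2l.
Qed.

(* Nodes stand for dyadic cubes, [V] for volume, [W] for weight and [K] for
   [2^d]. The predicate [P] singles out the nodes that are genuine cubes. *)
Context {C : Type} {I : finType} (child : C -> I -> C) (V W : C -> R).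
Variable (P : C -> Prop).
Hypothesis P_child : forall c i, P c -> P (child c i).
Hypothesis V_gt0 : forall c, P c -> 0 < V c.
Hypothesis W_ge0 : forall c, P c -> 0 <= W c.
Hypothesis V_sum : forall c, P c -> V c = \sum_i V (child c i).
Hypothesis W_sum : forall c, P c -> W c = \sum_i W (child c i).
Variable K : R.
Hypothesis V_doubling : forall c i, P c -> V c <= K * V (child c i).

Definition mean c := W c / V c.

(** The integral, with respect to [mu], of [phi] applied to the generation-[n]
    maximal function below [c]. The argument [t] is the largest mean met so far,
    so the tree can be explored by recursion from any node. *)
Fixpoint leaf_sum (phi : R -> R) (mu : C -> R) n c t : R :=
  let t' := Num.max t (mean c) in
  if n is n'.+1 then \sum_i leaf_sum phi mu n' (child c i) t'
  else phi t' * mu c.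

Lemma leaf_sum_max phi mu n c t :
  leaf_sum phi mu n c (Num.max t (mean c)) = leaf_sum phi mu n c t.
Proof. by case: n => [|n] /=; rewrite -maxA maxxx. Qed.

Lemma leaf_sum_ge0 phi mu n c t : (forall s, 0 <= phi s) ->
  (forall c, P c -> 0 <= mu c) -> P c -> 0 <= leaf_sum phi mu n c t.
Proof.
move=> phi0 mu0; elim: n c t => [|n IH] c t Pc /=.
  by rewrite mulr_ge0// mu0.
by apply: sumr_ge0 => i _; exact/IH/P_child.
Qed.

Lemma mean_ge0 c : P c -> 0 <= mean c.
Proof. by move=> Pc; rewrite divr_ge0 ?W_ge0// ltW// V_gt0. Qed.

Lemma mean_child c i : P c -> mean (child c i) <= K * mean c.
Proof.
move=> Pc; have Pi := P_child i Pc.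
rewrite ler_pdivrMr ?V_gt0//.
rewrite (_ : K * mean c * V (child c i) = W c * (K * V (child c i)) / V c);
  last first.
  by rewrite /mean; field; rewrite gt_eqF// V_gt0.
rewrite ler_pdivlMr ?V_gt0//.
have WW : W (child c i) <= W c.
  rewrite (W_sum Pc) (bigD1 i)//= lerDl; apply: sumr_ge0 => j _.
  exact/W_ge0/P_child.
by rewrite ler_pM ?V_doubling// ?W_ge0// ltW// V_gt0.
Qed.

Hypothesis K_ge1 : 1 <= K.
Variable e : R.
Hypothesis e_gt0 : 0 < e.

(** How much the weighted sum can grow at a node. If the maximum grows, then its
    new value [t'] is the mean at [c], so that [W c <= t' V c], and the excess
    over [t] is controlled by [young_increment]. *)
Lemma weight_increment c t : P c -> 0 <= t -> mean c <= K * t ->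
  forall t', t' = Num.max t (mean c) ->
  (t' `^ e - t `^ e) * W c <=
  K * (e / (1 + e)) * (t' `^ (1 + e) - t `^ (1 + e)) * V c.
Proof.
move=> Pc t0 cK t' t'E.
have tt' : t <= t' by rewrite t'E le_max lexx.
have t'0 : 0 <= t' by exact: le_trans tt'.
have V0 := V_gt0 Pc.
apply: (@le_trans _ _ ((t' `^ e - t `^ e) * t' * V c)).
  rewrite -mulrA ler_wpM2l//; first by rewrite subr_ge0 le_powRl ?nnegrE.
  by rewrite -ler_pdivrMr// t'E le_max lexx orbT.
rewrite ler_wpM2r ?(ltW V0)// young_increment//.
by rewrite t'E ge_max cK ler_peMl.
Qed.

(** The contributions of [weight_increment] telescope along the branches. The
    hypothesis [mean c <= K t] propagates to the children by [mean_child]. *)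
Lemma leaf_sum_weight_le n c t : P c -> 0 <= t -> mean c <= K * t ->
  leaf_sum (@powR R ^~ e) W n c t - t `^ e * W c <= K * (e / (1 + e)) *
    (leaf_sum (@powR R ^~ (1 + e)) V n c t - t `^ (1 + e) * V c).
Proof.
elim: n c t => [|n IH] c t Pc t0 cK.
all: have := weight_increment Pc t0 cK (erefl _).
  by rewrite /=; lra.
set t' := Num.max t (mean c) => step.
have t'0 : 0 <= t' by rewrite le_max t0.
have step' : leaf_sum (@powR R ^~ e) W n.+1 c t - t' `^ e * W c <=
    K * (e / (1 + e)) *
    (leaf_sum (@powR R ^~ (1 + e)) V n.+1 c t - t' `^ (1 + e) * V c).
  rewrite /= -/t' (W_sum Pc) (V_sum Pc) 2!mulr_sumr -!sumrB mulr_sumr.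
  apply: ler_sum => i _; apply: IH => //; first exact: P_child.
  apply: le_trans (mean_child i Pc) _.
  by rewrite ler_wpM2l ?(le_trans _ K_ge1)// le_max lexx orbT.
move: step step'; move: (_ * (e / _)) (leaf_sum _ _ _ _ _) (leaf_sum _ _ _ _ _).
by move=> k S T; lra.
Qed.

Variable A : R.
(* The [A_infinity] condition: starting the maximum afresh at [c] (value [0]), the
   integral of the maximal function of [c] is at most [A W c]. *)
Hypothesis leaf_sum_maximal_le : forall n c, P c -> 0 < mean c ->
  leaf_sum id V n c 0 <= A * W c.

(** When the maximum grows at [c], it becomes the mean of [c], and the previous
    value [t] has no influence below [c]. The [A_infinity] condition then applies
    to [c] itself; when it does not grow both sides vanish. *)
Lemma maximal_increment n c t : P c -> 0 <= t -> forall t', t' = Num.max t (mean c) ->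
  (t' `^ e - t `^ e) * leaf_sum id V n c t <=
  (t' `^ e - t `^ e) * (A * W c).
Proof.
move=> Pc t0 t' t'E; have [ct|tc] := leP (mean c) t.
  by rewrite t'E max_l// subrr !mul0r.
have tt' : t <= t' by rewrite t'E le_max lexx.
rewrite ler_wpM2l ?subr_ge0 ?le_powRl ?nnegrE ?(le_trans t0 tt')//.
have t'0 : t' = Num.max 0 (mean c) by rewrite t'E !max_r ?mean_ge0// ltW.
rewrite -leaf_sum_max -t'E t'0 leaf_sum_max.
by rewrite leaf_sum_maximal_le// (le_lt_trans t0 tc).
Qed.

(** Summation by parts: one factor [M] of [M^(1+e)] is kept and integrated over
    the subtree, while the increments of [M^e] are summed over the nodes. *)
Lemma leaf_sum_volume_le n c t : P c -> 0 <= t ->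
  leaf_sum (@powR R ^~ (1 + e)) V n c t - t `^ e * leaf_sum id V n c t <=
  A * (leaf_sum (@powR R ^~ e) W n c t - t `^ e * W c).
Proof.
elim: n c t => [|n IH] c t Pc t0.
all: have step n := maximal_increment n Pc t0 (erefl _).
all: set t' := Num.max t (mean c) in step.
all: have t'0 : 0 <= t' by rewrite le_max t0.
- by have := step 0%N; rewrite /= -/t' powR_split//; lra.
- have step' : leaf_sum (@powR R ^~ (1 + e)) V n.+1 c t -
      t' `^ e * leaf_sum id V n.+1 c t <=
      A * (leaf_sum (@powR R ^~ e) W n.+1 c t - t' `^ e * W c).
    rewrite /= -/t' (W_sum Pc) 2!mulr_sumr -!sumrB mulr_sumr.
    by apply: ler_sum => i _; apply: IH => //; exact: P_child.
  have := step n.+1; move: step'.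
  move: (leaf_sum _ _ _ _ _) (leaf_sum _ _ _ _ _) (leaf_sum _ _ _ _ _).
  by move=> S U T; lra.
Qed.

(** The two comparisons together read [S <= m^e W + k A S] with [k A <= 1/2],
    and the finite quantity [S] can be absorbed into the left-hand side. *)
Lemma leaf_sum_reverse_holder n c : P c -> 0 < mean c -> 0 <= A ->
  2 * K * A * e <= 1 + e ->
  leaf_sum (@powR R ^~ e) W n c (mean c) <= 2 * (mean c `^ e * W c).
Proof.
move=> Pc c0 A0 KAe; have m0 := ltW c0.
set S := leaf_sum _ _ _ _ _; set k := K * (e / (1 + e)).
have e1 : 0 < 1 + e by rewrite addr_gt0.
have k0 : 0 <= k by rewrite mulr_ge0 ?(le_trans _ K_ge1)// divr_ge0// ltW.
have kA : k * A <= 1 / 2.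
  rewrite (_ : k * A = (2 * K * A * e) / (1 + e) / 2); last first.
    by rewrite /k; field; rewrite gt_eqF.
  by rewrite ler_pM2r// ler_pdivrMr// mul1r.
have S0 : 0 <= S by apply: leaf_sum_ge0 => // s; exact: powR_ge0.
have h1 := leaf_sum_weight_le n Pc m0 (ler_peMl m0 K_ge1).
have h2 := leaf_sum_volume_le n Pc m0.
have h3 : leaf_sum id V n c (mean c) <= A * W c.
  rewrite -[X in leaf_sum _ _ _ _ X](@max_r _ _ 0 (mean c))// leaf_sum_max.
  exact: leaf_sum_maximal_le.
move: h1 h2 h3; rewrite -/S -/k.
set T := leaf_sum _ _ _ _ _; set U := leaf_sum _ _ _ _ _ => h1 h2 h3.
have TS : T <= A * S.
  have := ler_wpM2l (powR_ge0 (mean c) e) h3; move: h2; lra.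
have h4 : k * T <= S / 2.
  apply: le_trans (ler_wpM2l k0 TS) _; rewrite mulrA.
  by have := ler_wpM2r S0 kA; lra.
have h5 : 0 <= k * (mean c `^ (1 + e) * V c).
  exact: mulr_ge0 k0 (mulr_ge0 (powR_ge0 _ _) (ltW (V_gt0 Pc))).
move: h1 h4 h5; lra.
Qed.

End stopping_tree.

(** * Lebesgue outer measure: half-spaces and translations *)

Section lebesgue_boxes.
Context {R : realType} {d : nat}.
Implicit Types (x v a b : 'rV[R]_d) (i : 'I_d) (c l h : R).
Local Notation boxT := (option ('rV[R]_d * 'rV[R]_d)).

Definition upd v i c : 'rV[R]_d := \row_j if j == i then c else v 0 j.

(** Coordinatewise clipping at the hyperplane [x_i = c]. The two pieces of a box
    overlap in a face, and one of them may be an empty box, of volume [0]. *)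
Definition cut_below i c (B : boxT) : boxT :=
  if B is Some (a, b) then Some (a, upd b i (Num.min (b 0 i) c)) else None.

Definition cut_above i c (B : boxT) : boxT :=
  if B is Some (a, b) then Some (upd a i (Num.max (a 0 i) c), b) else None.

Lemma box_cut_below i c B x : box B x -> x 0 i <= c -> box (cut_below i c B) x.
Proof.
case: B => [[a b]|]//= Bx xc j; rewrite mxE; have /andP[ax xb] := Bx j.
case: eqP => [ji|_]; last by rewrite ax xb.
by rewrite -ji in xc *; rewrite ax le_min xb xc.
Qed.

Lemma box_cut_above i c B x : box B x -> c <= x 0 i -> box (cut_above i c B) x.
Proof.
case: B => [[a b]|]//= Bx xc j; rewrite mxE; have /andP[ax xb] := Bx j.
case: eqP => [ji|_]; last by rewrite ax xb.
by rewrite -ji in xc *; rewrite xb ge_max ax xc.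
Qed.

Lemma box_vol_cut i c B :
  (box_vol (cut_below i c B) + box_vol (cut_above i c B) <= box_vol B)%E.
Proof.
case: B => [[a b]|] /=; last by rewrite adde0.
have prodE (f : 'I_d -> R) : \prod_j f j = f i * \prod_(j | j != i) f j.
  by rewrite (bigD1 i).
rewrite -EFinD lee_fin !prodE !mxE eqxx.
rewrite (eq_bigr (fun j => Num.max 0 (b 0 j - a 0 j))); last first.
  by move=> j /negPf ji; rewrite mxE ji.
rewrite [X in _ + _ * X](eq_bigr (fun j => Num.max 0 (b 0 j - a 0 j))); last first.
  by move=> j /negPf ji; rewrite mxE ji.
rewrite -mulrDl ler_wpM2r//.
  by apply: prodr_ge0 => j _; rewrite le_max lexx.
by rewrite /Num.max /Num.min; do !case: ifPn; lra.
Qed.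

(** Cutting every box of a covering of [Z] along [f] and [g] yields coverings of
    [Z `&` X] and [Z `&` Y]. With complementary [X] and [Y] this is the
    Caratheodory criterion. *)
Lemma lebesgue_outer_cover_le (X Y Z : set 'rV[R]_d) (f g : boxT -> boxT) :
  (forall B, box B `&` X `<=` box (f B)) ->
  (forall B, box B `&` Y `<=` box (g B)) ->
  (forall B, (box_vol (f B) + box_vol (g B) <= box_vol B)%E) ->
  (lebesgue_outer (Z `&` X) + lebesgue_outer (Z `&` Y) <= lebesgue_outer Z)%E.
Proof.
move=> fX gY fg; apply: le_ereal_inf_tmp => _ [B ZB <-].
apply: (@le_trans _ _ (\sum_(k <oo) box_vol (f (B k)) +
                       \sum_(k <oo) box_vol (g (B k)))%E); last first.
  rewrite -nneseriesD; [|by move=> *; exact: box_vol_ge0..].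
  apply: lee_nneseries => [k _ _|k _]; last exact: fg.
  by apply: adde_ge0; exact: box_vol_ge0.
apply: leeD; apply: ereal_inf_lbound.
- by exists (f \o B) => // x [/ZB[k _ Bx] Xx]; exists k => //=; exact: fX.
- by exists (g \o B) => // x [/ZB[k _ Bx] Yx]; exists k => //=; exact: gY.
Qed.

Lemma measurable_le_coord i c : measurable ([set x : Rd R d | x 0 i <= c]).
Proof.
apply: le_caratheodory_measurable => X.
apply: (@lebesgue_outer_cover_le _ _ _ (cut_below i c) (cut_above i c)).
- by move=> B x [Bx xc]; exact: box_cut_below.
- by move=> B x [Bx] /negP; rewrite -ltNge => /ltW; exact: box_cut_above.
- exact: box_vol_cut.
Qed.

Lemma measurable_ge_coord i c : measurable ([set x : Rd R d | c <= x 0 i]).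
Proof.
apply: le_caratheodory_measurable => X.
rewrite addeC.
apply: (@lebesgue_outer_cover_le _ _ _ (cut_below i c) (cut_above i c)).
- by move=> B x [Bx] /negP; rewrite -ltNge => /ltW; exact: box_cut_below.
- by move=> B x [Bx xc]; exact: box_cut_above.
- exact: box_vol_cut.
Qed.

Lemma lebesgue_outer_box B : (lebesgue_outer (box B) <= @box_vol R d B)%E.
Proof.
apply: ereal_inf_lbound; exists (fun k => if k == 0%N then B else None).
  by move=> x Bx; exists 0%N.
rewrite (nneseries_split 0%N 1%N); last first.
  by move=> k _; case: k => [|k]//; exact: box_vol_ge0.
rewrite big_nat1 eseries0 ?adde0//.
by move=> [|k].
Qed.

(** Translating the boxes of a covering does not change their volumes. *)
Lemma lebesgue_outer_shift (X : set 'rV[R]_d) v :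
  lebesgue_outer [set x | X (x + v)] = lebesgue_outer X.
Proof.
have shift_le (Y : set 'rV[R]_d) u :
    (lebesgue_outer [set x | Y (x + u)%R] <= lebesgue_outer Y)%E.
  apply: le_ereal_inf_tmp => _ [B YB <-]; apply: ereal_inf_lbound.
  exists (fun k => if B k is Some (a, b) then Some (a - u, b - u) else None).
    move=> x /= /YB[k _]; case Bk : (B k) => [[a b]|]//= abx.
    exists k => //; rewrite Bk => i; have := abx i.
    by rewrite !mxE lerBlDr lerBrDr.
  apply: eq_eseriesr => k _; case: (B k) => [[a b]|]//=; congr (_%:E).
  by apply: eq_bigr => i _; rewrite !mxE; congr Num.max; ring.
apply/le_anti; rewrite shift_le/=.
rewrite [leLHS](_ : _ = lebesgue_outer [set x | [set y | X (y + v)] (x - v)]);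
  first exact: shift_le.
by congr lebesgue_outer; apply/seteqP; split=> x /=; rewrite subrK.
Qed.

End lebesgue_boxes.

(** * Half-open cubes and their dyadic subdivision *)

Section half_open_cubes.
Context {R : realType} {d : nat}.
Implicit Types (x v a b : 'rV[R]_d) (i : 'I_d) (l h : R).
Local Notation leb := (@leb R d).

(** Half-open cubes make the dyadic children of a cube an exact partition. *)
Definition hcube (a : 'rV[R]_d) (l : R) : set (Rd R d) :=
  [set x : 'rV[R]_d | forall i, a 0 i <= x 0 i < a 0 i + l].

(** The lower corner of the child in the orthant [s] of the cube [(a, l)]. *)
Definition corner (a : 'rV[R]_d) (l : R) (s : {ffun 'I_d -> bool}) :
  'rV[R]_d := \row_i (a 0 i + (s i)%:R * (l / 2)).

Lemma hcube_subset_cube a l : hcube a l `<=` cube a l.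
Proof. by move=> x ax i; have /andP[-> /ltW ->] := ax i. Qed.

Lemma measurable_box (B : option ('rV[R]_d * 'rV[R]_d)) :
  measurable (box B : set (Rd R d)).
Proof.
case: B => [[a b]|]; last exact: measurable0.
rewrite (_ : box _ = \bigcap_(i in [set: 'I_d])
    ([set x : Rd R d | a 0 i <= (x : 'rV_d) 0 i] `&`
     [set x : Rd R d | (x : 'rV_d) 0 i <= b 0 i])); last first.
  apply/seteqP; split=> x /= ax i; last by apply/andP; have [] := ax i I.
  by move=> _; apply/andP.
apply: fin_bigcap_measurable => // i _; apply: measurableI.
  exact: measurable_ge_coord.
exact: measurable_le_coord.
Qed.

Lemma cubeE a l : cube a l = box (Some (a, \row_i (a 0 i + l))).
Proof. by apply/seteqP; split=> x ax i; have := ax i; rewrite mxE. Qed.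

Lemma measurable_cube a l : measurable (cube a l).
Proof. by rewrite cubeE; exact: measurable_box. Qed.

Lemma measurable_hcube a l : measurable (hcube a l).
Proof.
rewrite (_ : hcube a l = \bigcap_(i in [set: 'I_d])
    ([set x : Rd R d | a 0 i <= (x : 'rV_d) 0 i] `&`
     ~` [set x : Rd R d | a 0 i + l <= (x : 'rV_d) 0 i])); last first.
  apply/seteqP; split=> x /= ax i.
    by move=> _; have /andP[h1 h2] := ax i; split => //; apply/negP; rewrite -ltNge.
  by have [h1 /negP h2] := ax i I; rewrite h1/= ltNge.
apply: fin_bigcap_measurable => // i _; apply: measurableI.
  exact: measurable_ge_coord.
exact/measurableC/measurable_ge_coord.
Qed.

(** The missing part lies in the [d] upper faces, each contained in a box with one
    side of length [0]. *)
Lemma leb_cubeD_hcube a l : leb (cube a l `\` hcube a l) = 0%E.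
Proof.
(* faces are indexed by nat, and empty beyond d, for countable subadditivity *)
pose F (k : nat) : set (Rd R d) := cube a l `&`
  [set x | exists2 i : 'I_d, i = k :> nat & (x : 'rV_d) 0 i = a 0 i + l].
have F0 k : lebesgue_outer (F k) = 0%E.
  apply/le_anti; rewrite lebesgue_outer_ge0 andbT.
  have [kd|dk] := ltnP k d; last first.
    rewrite (_ : F k = set0) ?lebesgue_outer0//.
    by apply/seteqP; split=> // x [_ [i ik _]]; move: (ltn_ord i); rewrite ik ltnNge dk.
  (* the face is the box whose side in direction k shrinks to a point *)
  pose B : option ('rV[R]_d * 'rV[R]_d) :=
    Some (upd a (Ordinal kd) (a 0 (Ordinal kd) + l), \row_i (a 0 i + l)).
  have FB : F k `<=` box B.
    move=> x [ax [i ik xi]] j; have /andP[h1 h2] := ax j.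
    rewrite !mxE h2 andbT; case: eqP => [->|_//].
    by rewrite (_ : Ordinal kd = i) ?xi//; exact/val_inj.
  apply: le_trans (le_lebesgue_outer FB) _.
  apply: le_trans (lebesgue_outer_box B) _.
  by rewrite /= (bigD1 (Ordinal kd))//= !mxE eqxx subrr maxxx mul0r.
apply/le_anti; rewrite lebesgue_outer_ge0 andbT.
apply: (@le_trans _ _ (lebesgue_outer (\bigcup_k F k))).
  apply: le_lebesgue_outer => x [ax /existsNP[i /negP nxi]].
  exists i => //; split => //; exists i => //.
  have /andP[h1 h2] := ax i; apply/le_anti; rewrite h2/=.
  by move: nxi; rewrite h1/= -leNgt.
apply: le_trans (lebesgue_outer_sigma_subadditive _) _.
by rewrite eseries0.
Qed.

Lemma leb_cube a l : leb (cube a l) = leb (hcube a l).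
Proof.
rewrite -[cube a l](setDUK (@hcube_subset_cube a l)) measureU.
- by rewrite [X in (_ + X)%E]leb_cubeD_hcube adde0.
- exact: measurable_hcube.
- by apply: measurableD; [exact: measurable_cube|exact: measurable_hcube].
- exact: setDIK.
Qed.

Lemma integral_cube (f : Rd R d -> \bar R) a l :
  measurable_fun (cube a l) f -> (forall x, 0 <= f x)%E ->
  (\int[leb]_(x in cube a l) f x = \int[leb]_(x in hcube a l) f x)%E.
Proof.
move=> mf f0; have mc := measurable_cube a l; have mh := measurable_hcube a l.
rewrite (@ge0_negligible_integral _ _ _ _ _ (cube a l `\` hcube a l))//.
- by rewrite setDD setIidr//; exact: hcube_subset_cube.
- exact: measurableD.
- exact: leb_cubeD_hcube.
Qed.

Lemma leb_hcube_fin a l : leb (hcube a l) \is a fin_num.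
Proof.
rewrite ge0_fin_numE//; apply: (@le_lt_trans _ _ (leb (cube a l))).
  exact/le_lebesgue_outer/hcube_subset_cube.
by rewrite cubeE; apply: le_lt_trans (lebesgue_outer_box _) _; rewrite /= ltry.
Qed.

Lemma hcube_corner_subset a l s : 0 <= l -> hcube (corner a l s) (l / 2) `<=` hcube a l.
Proof.
move=> l0 x ax i; have := ax i; rewrite !mxE.
by case: (s i) => /=; lra.
Qed.

Lemma cube_corner_subset a l s : 0 <= l -> cube (corner a l s) (l / 2) `<=` cube a l.
Proof.
move=> l0 x ax i; have := ax i; rewrite !mxE.
by case: (s i) => /=; lra.
Qed.

Lemma trivIset_hcube_corner a l :
  trivIset setT (fun s => hcube (corner a l s) (l / 2)).
Proof.
move=> s t _ _ [x [sx tx]]; apply/ffunP => i.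
have := sx i; have := tx i; rewrite !mxE.
by case: (s i); case: (t i) => //= *; exfalso; lra.
Qed.

Lemma hcube_split a l : 0 <= l ->
  hcube a l = \big[setU/set0]_(s : {ffun 'I_d -> bool}) hcube (corner a l s) (l / 2).
Proof.
move=> l0; rewrite -bigcup_seq; apply/seteqP; split=> x /=.
  move=> ax; exists [ffun i => a 0 i + l / 2 <= x 0 i] => //=.
    by rewrite mem_index_enum.
  move=> i; have := ax i; rewrite !mxE ffunE.
  by case: (leP (a 0 i + l / 2) (x 0 i)) => /=; lra.
by case=> s _; exact: hcube_corner_subset.
Qed.

Lemma integral_hcube_split (f : Rd R d -> \bar R) a l : 0 <= l ->
  measurable_fun setT f -> (forall x, 0 <= f x)%E ->
  (\int[leb]_(x in hcube a l) f x = \sum_(s : {ffun 'I_d -> bool})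
     \int[leb]_(x in hcube (corner a l s) (l / 2)) f x)%E.
Proof.
move=> l0 mf f0; rewrite hcube_split// ge0_integral_bigsetU//.
- by move=> s; exact: measurable_hcube.
- exact: index_enum_uniq.
- by apply: sub_trivIset (@trivIset_hcube_corner a l).
- exact: measurable_funS mf.
Qed.

Lemma integral1E (D : set (Rd R d)) : measurable D ->
  (\int[leb]_(x in D) 1 = leb D)%E.
Proof. by move=> mD; rewrite integral_cst// mul1e. Qed.

Lemma leb_hcube_shift a v l : leb (hcube (a + v) l) = leb (hcube a l).
Proof.
rewrite /leb -[LHS](lebesgue_outer_shift _ v); congr lebesgue_outer.
by apply/seteqP; split=> x ax i; have := ax i; rewrite !mxE; lra.
Qed.

(** The [2^d] children are translates of one another and partition the cube. *)
Lemma leb_hcube_corner a l s : 0 <= l ->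
  leb (hcube a l) = ((2 ^+ d)%:E * leb (hcube (corner a l s) (l / 2)))%E.
Proof.
move=> l0; have cE t : leb (hcube (corner a l t) (l / 2)) = leb (hcube a (l / 2)).
  rewrite (_ : corner a l t = a + \row_i ((t i)%:R * (l / 2))) ?leb_hcube_shift//.
  by apply/rowP => i; rewrite !mxE.
rewrite -[LHS]integral1E; last exact: measurable_hcube.
rewrite integral_hcube_split//.
under eq_bigr do rewrite (integral1E (measurable_hcube _ _)) cE.
rewrite cE -(fineK (leb_hcube_fin a (l / 2))) sumEFin -EFinM sumr_const.
by rewrite card_ffun card_bool card_ord; congr (_%:E); rewrite -[LHS]mulr_natl natrX.
Qed.

End half_open_cubes.

(** * Integrals of nonnegative functions *)

Section integral_lemmas.
Context {dd : measure_display} {T : measurableType dd} {R : realType}.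
Variable mu : {measure set T -> \bar R}.
Local Open Scope ereal_scope.

Lemma integral_bigcup_le (A : set T) (B : (set T)^nat) (f : T -> \bar R) :
  measurable A -> (forall k, measurable (B k)) -> A `<=` \bigcup_k B k ->
  measurable_fun setT f -> (forall x, 0 <= f x) ->
  \int[mu]_(x in A) f x <= \sum_(k <oo) \int[mu]_(x in A `&` B k) f x.
Proof.
move=> mA mB AB mf f0; have fB0 k x : 0 <= (f \_ (B k)) x by apply: erestrict_ge0.
have mfB k : measurable_fun A (f \_ (B k)).
  apply: (@measurable_funS _ _ _ _ setT) => //.
  by apply/(measurable_restrictT _ (mB k)); exact: measurable_funS mf.
under eq_eseriesr do rewrite integral_mkcondr.
rewrite -integral_nneseries//; apply: ge0_le_integral => //.
- exact: measurable_funS mf.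
- by apply: ge0_emeasurable_sum => // k x _ _; exact: fB0.
move=> x /AB[k _ Bx]; apply: (@le_trans _ _ (\sum_(0 <= i < k.+1) (f \_ (B i)) x)).
  rewrite big_nat_recr//= {2}/patch mem_set// leeDr//.
  by apply: sume_ge0 => i _; exact: fB0.
exact: nneseries_lim_ge.
Qed.

(** The integral of a nonnegative function is a supremum over the simple functions
    below it, so it is monotone without any measurability. This serves to
    integrate the uncentered maximal function, whose measurability would need an
    argument of its own. *)
Lemma le_integral_nonmeasurable (D E : set T) (f g : T -> \bar R) :
  D `<=` E -> (forall x, D x -> 0 <= f x) -> (forall x, E x -> 0 <= g x) ->
  (forall x, D x -> f x <= g x) ->
  \int[mu]_(x in D) f x <= \int[mu]_(x in E) g x.
Proof.
move=> DE f0 g0 fg; rewrite integral_mkcond [leRHS]integral_mkcond.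
have fg' x : (f \_ D) x <= (g \_ E) x.
  rewrite /patch; case: ifPn => [/set_mem Dx|_].
    by rewrite mem_set ?fg//; exact: DE.
  by case: ifPn => // /set_mem /g0.
rewrite !ge0_integralTE; [|by apply: erestrict_ge0..].
apply: ereal_sup_le => _ [h hf <-]; exists h => // x.
exact: le_trans (hf x) (fg' x).
Qed.

(** Monotone convergence, in the form in which a bound on the integrals of an
    increasing sequence passes to any function below its supremum. *)
Lemma integral_le_of_monotone_sup (D : set T) (f : (T -> \bar R)^nat)
    (h : T -> \bar R) (K : \bar R) : measurable D ->
  (forall n, measurable_fun D (f n)) -> (forall n x, D x -> 0 <= f n x) ->
  (forall x, D x -> {homo f ^~ x : n m / (n <= m)%N >-> n <= m}) ->
  measurable_fun D h -> (forall x, D x -> 0 <= h x) ->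
  {ae mu, forall x, D x -> h x <= ereal_sup (range (f ^~ x))} ->
  (forall n, \int[mu]_(x in D) f n x <= K) ->
  \int[mu]_(x in D) h x <= K.
Proof.
move=> mD mf f0 ndf mh h0 hf fK.
have cvgf x : D x -> f n x @[n --> \oo] --> ereal_sup (range (f ^~ x)).
  by move=> Dx; apply: ereal_nondecreasing_cvgn; exact: ndf.
have limf x : D x -> limn (f ^~ x) = ereal_sup (range (f ^~ x)).
  by move=> /cvgf/cvg_lim; exact.
apply: (@le_trans _ _ (\int[mu]_(x in D) limn (f ^~ x))).
  apply: ae_ge0_le_integral => //.
  - move=> x Dx; apply: lime_ge; last by apply: nearW => n; exact: f0.
    by apply/cvg_ex; eexists; exact: cvgf.
  - apply: (emeasurable_fun_cvg f) => // x Dx; rewrite limf//; exact: cvgf.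
  by apply: filterS hf => x hfx Dx; rewrite limf//; exact: hfx.
rewrite monotone_convergence//; apply: lime_le; last exact: nearW.
by apply/cvg_ex; eexists; exact: cvg_monotone_convergence.
Qed.

Lemma measurable_EFin_powR (D : set T) (f : T -> R) (p : R) :
  measurable_fun setT f -> measurable_fun D (fun x => (f x `^ p)%:E).
Proof.
move=> mf; apply: (measurable_funS measurableT (@subsetT _ D)).
by apply/measurable_EFinP; exact: measurableT_comp (measurable_powR p) mf.
Qed.

End integral_lemmas.

(** * The dyadic maximal function *)

Section dyadic_maximal_function.
Context {R : realType} {d : nat}.
Local Notation leb := (@leb R d).
Local Notation node := ('rV[R]_d * R)%type.
Implicit Types (c : node) (s : {ffun 'I_d -> bool}) (x : Rd R d) (t : R).

(** A node is a cube given by its lower corner and its side length. *)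
Definition region c : set (Rd R d) := hcube c.1 c.2.

Definition child c s : node := (corner c.1 c.2 s, c.2 / 2).

Definition orthant c x : {ffun 'I_d -> bool} :=
  [ffun i => c.1 0 i + c.2 / 2 <= (x : 'rV[R]_d) 0 i].

Lemma orthant_child c s x : 0 < c.2 -> region (child c s) x -> orthant c x = s.
Proof.
move=> c0 sx; apply/ffunP => i; have := sx i; rewrite !mxE ffunE /=.
by case: (leP (c.1 0 i + c.2 / 2) _); case: (s i) => //= *; exfalso; lra.
Qed.

Lemma measurable_orthant c s : measurable [set x | orthant c x = s].
Proof.
rewrite (_ : [set _ | _] = \bigcap_(i in [set: 'I_d]) (if s i
    then [set x : Rd R d | c.1 0 i + c.2 / 2 <= (x : 'rV_d) 0 i]
    else ~` [set x : Rd R d | c.1 0 i + c.2 / 2 <= (x : 'rV_d) 0 i])); last first.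
  apply/seteqP; split=> x /=.
    by move=> <- i _; rewrite ffunE; case: ifPn => // /negP.
  move=> xs; apply/ffunP => i; rewrite ffunE; have := xs i I.
  by case: (s i) => //= /negP/negPf.
apply: fin_bigcap_measurable => // i _.
by case: (s i); [|apply: measurableC]; exact: measurable_ge_coord.
Qed.

Variable m : node -> R.

(** The maximum of [t] and of the values of [m] at the dyadic descendants of [c]
    of generation at most [n] that contain [x]; the tree is descended by choosing
    at each step the orthant of [x]. For [m] the averages of [w] this is the
    dyadic maximal function. *)
Fixpoint dyadic_max n c t x : R :=
  let t' := Num.max t (m c) in
  if n is n'.+1 then dyadic_max n' (child c (orthant c x)) t' x else t'.

Lemma dyadic_max_ge n c t x : Num.max t (m c) <= dyadic_max n c t x.
Proof.
elim: n c t => [|n IH] c t //=.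
by apply: le_trans (IH _ _); rewrite le_max lexx.
Qed.

Lemma dyadic_max_ge0 n c t x : 0 <= t -> 0 <= dyadic_max n c t x.
Proof. by move=> t0; apply: le_trans (dyadic_max_ge _ _ _ _); rewrite le_max t0. Qed.

Lemma dyadic_max_homo c t x :
  {homo (fun n => dyadic_max n c t x) : n k / (n <= k)%N >-> n <= k}.
Proof.
apply: homo_leq => [//|? ? ?|n]; first exact: le_trans.
elim: n c t => [|n IH] c t; first by rewrite [leRHS]/= le_max lexx.
exact: IH.
Qed.

Lemma dyadic_max_child n c s t x : 0 < c.2 -> region (child c s) x ->
  dyadic_max n.+1 c t x = dyadic_max n (child c s) (Num.max t (m c)) x.
Proof. by move=> c0 sx /=; rewrite (orthant_child c0 sx). Qed.

Lemma measurable_dyadic_max n c t : measurable_fun setT (dyadic_max n c t).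
Proof.
elim: n c t => [|n IH] c t; first exact: measurable_cst.
move=> _ Y mY; rewrite setTI.
rewrite (_ : _ @^-1` _ = \bigcup_(s in [set: {ffun 'I_d -> bool}])
   ([set x | orthant c x = s] `&`
    dyadic_max n (child c s) (Num.max t (m c)) @^-1` Y)); last first.
  apply/seteqP; split=> x /=; first by move=> Yx; exists (orthant c x).
  by move=> [s _ [<-]].
apply: fin_bigcup_measurable => // s _; apply: measurableI.
  exact: measurable_orthant.
by rewrite -[X in measurable X]setTI; exact: IH.
Qed.

End dyadic_maximal_function.

Section dyadic_averages.
Context {R : realType} {d : nat}.
Local Notation leb := (@leb R d).
Local Notation node := ('rV[R]_d * R)%type.
Implicit Types (c : node) (s : {ffun 'I_d -> bool}) (x : Rd R d) (t : R).

Definition mass (rho : Rd R d -> R) c : R :=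
  fine (\int[leb]_(x in region c) (rho x)%:E)%E.

Lemma measurable_region c : measurable (region c).
Proof. exact: measurable_hcube. Qed.

Section density.
Variable rho : Rd R d -> R.
Hypothesis rho_ge0 : forall x, 0 <= rho x.
Hypothesis mrho : measurable_fun setT rho.
Hypothesis rho_fin : forall c, (\int[leb]_(x in region c) (rho x)%:E < +oo)%E.

Let mErho : measurable_fun setT (fun x => (rho x)%:E).
Proof. exact/measurable_EFinP. Qed.

Lemma massE c : (\int[leb]_(x in region c) (rho x)%:E = (mass rho c)%:E)%E.
Proof.
rewrite fineK// ge0_fin_numE//; apply: integral_ge0 => x _.
by rewrite lee_fin.
Qed.

Lemma mass_ge0 c : 0 <= mass rho c.
Proof. by apply/fine_ge0/integral_ge0 => x _; rewrite lee_fin. Qed.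

Lemma mass_sum c : 0 < c.2 -> mass rho c = \sum_s mass rho (child c s).
Proof.
move=> c0; apply: EFin_inj; rewrite -massE /region integral_hcube_split ?(ltW c0)//.
by rewrite -sumEFin; apply: eq_bigr => s _; rewrite -(massE (child c s)).
Qed.

Lemma measurable_density (g : Rd R d -> R) (phi : R -> R) :
  measurable_fun setT g -> measurable_fun setT phi ->
  measurable_fun setT (fun x => (phi (g x) * rho x)%:E).
Proof.
move=> mg mphi.
have mphig : measurable_fun setT (phi \o g).
  by apply: measurableT_comp.
have := measurable_funM mphig mrho.
by move/measurable_EFinP.
Qed.

(** The dyadic maximal function is constant on the cubes of generation [n], so its
    integrals are the sums over the leaves of the tree. *)
Lemma integral_dyadic_max (V W : node -> R) (phi : R -> R) n c t :
  (forall r, 0 <= r -> 0 <= phi r) -> measurable_fun setT phi ->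
  0 < c.2 -> 0 <= t ->
  (\int[leb]_(x in region c)
     (phi (dyadic_max (mean V W) n c t x) * rho x)%:E =
   (leaf_sum child V W phi (mass rho) n c t)%:E)%E.
Proof.
move=> phi0 mphi; elim: n c t => [|n IH] c t c0 t0.
  rewrite /=; set t' := Num.max _ _; have t'0 : 0 <= t' by rewrite le_max t0.
  rewrite EFinM -(massE c) -ge0_integralZl//.
  - exact: measurable_region.
  - exact: measurable_funS mErho.
  - by move=> x _; rewrite lee_fin.
  - by rewrite lee_fin phi0.
have := measurable_density (measurable_dyadic_max (mean V W) n.+1 c t) mphi.
have := fun x => dyadic_max_ge0 (mean V W) n.+1 c x t0.
have := fun s x => @dyadic_max_child _ _ (mean V W) n c s t x c0.
move: (dyadic_max _ n.+1 c t) => g gs g0 mg.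
rewrite [LHS]integral_hcube_split ?(ltW c0)//; last first.
  by move=> x; rewrite lee_fin mulr_ge0// phi0.
rewrite /= -sumEFin; apply: eq_bigr => s _.
rewrite -IH ?divr_gt0//; last by rewrite le_max t0.
by apply: eq_integral => x /set_mem sx; rewrite (gs s).
Qed.

End density.

End dyadic_averages.

(** * Dyadic differentiation of the integral *)

Section differentiation.
Context {R : realType} {d : nat}.
Local Notation leb := (@leb R d).
Local Notation node := ('rV[R]_d * R)%type.
Implicit Types (c : node) (s : {ffun 'I_d -> bool}) (x y : Rd R d) (t r : R).

Definition vol c : R := fine (leb (region c)).

Lemma volE c : (leb (region c) = (vol c)%:E)%E.
Proof. by rewrite fineK// leb_hcube_fin. Qed.

Lemma vol_ge0 c : 0 <= vol c.
Proof. exact/fine_ge0/lebesgue_outer_ge0. Qed.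

Lemma vol_child c s : 0 <= c.2 -> vol c = 2 ^+ d * vol (child c s).
Proof.
move=> c0; apply: EFin_inj; rewrite EFinM -!volE.
exact: leb_hcube_corner.
Qed.

Lemma vol_child_gt0 c s : 0 <= c.2 -> 0 < vol c -> 0 < vol (child c s).
Proof. by move=> c0; rewrite (vol_child s c0) pmulr_rgt0// exprn_gt0. Qed.

Variable w : Rd R d -> R.
Hypothesis w_ge0 : forall x, 0 <= w x.
Hypothesis mw : measurable_fun setT w.
Hypothesis w_fin : forall c, (\int[leb]_(x in region c) (w x)%:E < +oo)%E.

Let mEw : measurable_fun setT (fun x => (w x)%:E).
Proof. exact/measurable_EFinP. Qed.

Local Notation M := (dyadic_max (mean vol (mass w))).

(** The set [P] is the union of the cubes of generation [n] that meet [X]. Each of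
    them contains a point where [M] is at most [r], hence has average at most [r],
    and each point of it is within the side length of a point of [X]. *)
Lemma dyadic_hull n c t r (X : set (Rd R d)) : 0 < c.2 -> 0 < vol c ->
  (forall x, region c x -> X x -> M n c t x <= r) ->
  exists P : set (Rd R d), [/\ measurable P, P `<=` region c,
    region c `&` X `<=` P,
    (forall x, P x -> exists2 y, X y &
      forall i, `|(x : 'rV_d) 0 i - (y : 'rV_d) 0 i| <= c.2 / 2 ^+ n) &
    (\int[leb]_(x in P) (w x)%:E <= r%:E * leb P)%E].
Proof.
elim: n c t => [|n IH] c t c0 vc XM.
  have [[y [cy Xy]]|nX] := pselect (exists y, region c y /\ X y); last first.
    exists set0; split=> //; first by move=> x [cx Xx]; apply: nX; exists x.
    by rewrite integral_set0 measure0 mule0.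
  exists (region c); split => //.
  - exact: measurable_region.
  - move=> x cx; exists y => // i; rewrite expr0 divr1 ler_norml.
    by have := cx i; have := cy i; lra.
  - rewrite volE massE// -EFinM lee_fin.
    have := XM _ cy Xy; rewrite /= ge_max => /andP[_].
    by rewrite /mean ler_pdivrMr.
have XMs s : forall x, region (child c s) x -> X x ->
    M n (child c s) (Num.max t (mean vol (mass w) c)) x <= r.
  move=> x sx Xx; rewrite -(dyadic_max_child _ _ _ c0 sx); apply: XM => //.
  exact: (hcube_corner_subset (ltW c0) sx).
have /choice[P PP] := fun s => IH (child c s) _ (divr_gt0 c0 (ltr0Sn _ _))
  (vol_child_gt0 s (ltW c0) vc) (XMs s).
have mP s : measurable (P s) by have [] := PP s.
have Pc s : P s `<=` region (child c s) by have [] := PP s.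
have tP : trivIset setT P.
  move=> s1 s2 _ _ [x [x1 x2]]; apply: (@trivIset_hcube_corner R d c.1 c.2) => //.
  by exists x; split; [exact: (Pc s1)|exact: (Pc s2)].
have intP (f : Rd R d -> \bar R) : measurable_fun setT f -> (forall x, 0 <= f x)%E ->
    (\int[leb]_(x in \big[setU/set0]_s P s) f x =
     \sum_s \int[leb]_(x in P s) f x)%E.
  move=> mf f0; rewrite ge0_integral_bigsetU//.
  - exact: index_enum_uniq.
  - exact: sub_trivIset tP.
  - exact: measurable_funS mf.
have mUP : measurable (\big[setU/set0]_s P s) by exact: bigsetU_measurable.
exists (\big[setU/set0]_s P s); split => //.
- rewrite -bigcup_seq => x [s _ /Pc]; exact: hcube_corner_subset (ltW c0) _.
- move=> x [cx Xx]; rewrite -bigcup_seq.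
  move: cx; rewrite /region hcube_split ?(ltW c0)// -bigcup_seq => -[s ss sx].
  by exists s => //; have [_ _ XP _ _] := PP s; exact: XP.
- rewrite -bigcup_seq => x [s _ Px]; have [_ _ _ XP _] := PP s.
  have [y Xy xy] := XP x Px; exists y => // i.
  by rewrite exprS invfM mulrA; exact: xy.
- rewrite -(integral1E mUP) !intP// ge0_sume_distrr; last first.
    by move=> s _; rewrite integral1E.
  by apply: lee_sum => s _; rewrite integral1E//; have [] := PP s.
Qed.

Definition thicken (h : R) (B : option ('rV[R]_d * 'rV[R]_d)) :=
  if B is Some (a, b) then
    Some (\row_i (a 0 i - h) : 'rV[R]_d, \row_i (b 0 i + h) : 'rV[R]_d)
  else None.

(** The volume of a thickened box tends to that of the box. It is bounded by a
    product of affine functions of the thickness, also when the box is empty. *)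
Lemma le_box_vol_thicken (g : R) (l : R) B :
  (forall n, (g%:E <= box_vol (thicken (l / 2 ^+ n) B))%E) ->
  0 <= l -> (g%:E <= @box_vol R d B)%E.
Proof.
case: B => [[a b]|] + l0; last by move=> /(_ 0%N).
rewrite /= => gB; rewrite lee_fin.
pose f (n : nat) := \prod_(i < d) (Num.max 0 (b 0 i - a 0 i) + 2 * (l / 2 ^+ n)).
have gf n : g <= f n.
  have := gB n; rewrite lee_fin => /le_trans; apply; apply: ler_prod => i _.
  rewrite !mxE le_max lexx/=.
  have : 0 <= l / 2 ^+ n by rewrite divr_ge0.
  by rewrite /Num.max; do 2 case: ifPn; lra.
have fB : f n @[n --> \oo] --> \prod_(i < d) Num.max 0 (b 0 i - a 0 i).
  apply: cvg_big => [|i _]; first exact: mul_continuous.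
  rewrite -[X in _ --> X]addr0; apply: cvgD; first exact: cvg_cst.
  rewrite -[X in _ --> X](mulr0 2); apply: cvgMr.
  have := @cvg_geometric R l (2^-1) _; rewrite /geometric /=.
  rewrite ger0_norm ?invr_ge0// invf_lt1// ltr1n => /(_ isT).
  by under eq_fun do rewrite exprVn.
rewrite -(cvg_lim (@Rhausdorff R) fB).
by apply: limr_ge; [apply/cvg_ex; exists (\prod_(i < d) Num.max 0 (b 0 i - a 0 i))|
  exact: nearW].
Qed.

(** A covering of [A] by boxes bounds the weight of [A]: inside each box,
    [dyadic_hull] bounds the weight by [r] times the volume of a thickening of the
    box by the mesh, and the mesh tends to [0]. *)
Lemma weak_type c t r (A : set (Rd R d)) : 0 < c.2 -> 0 < vol c -> 0 < r ->
  measurable A -> A `<=` region c ->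
  (forall n x, A x -> M n c t x <= r) ->
  (\int[leb]_(x in A) (w x)%:E <= r%:E * leb A)%E.
Proof.
move=> c0 vc r0 mA Ac AM; have w0 x : (0 <= (w x)%:E)%E by rewrite lee_fin.
rewrite -lee_pdivrMl//; apply: le_ereal_inf_tmp => _ [B AB <-].
rewrite lee_pdivrMl// -nneseriesZl; last by move=> k _; exact: box_vol_ge0.
have mB k : measurable (box (B k) : set (Rd R d)) by exact: measurable_box.
apply: le_trans (integral_bigcup_le _ mA mB AB mEw w0) _.
apply: lee_nneseries => [k _ _|k _]; first exact: integral_ge0.
set I := integral _ _ _.
have I_fin : I \is a fin_num.
  rewrite ge0_fin_numE ?integral_ge0//; apply: le_lt_trans (w_fin c).
  apply: ge0_subset_integral => //; first exact: measurableI.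
  - exact: measurable_region.
  - exact: measurable_funS mEw.
  - by move=> x [/Ac].
rewrite -lee_pdivrMl// -(fineK I_fin) -EFinM.
apply: (@le_box_vol_thicken _ c.2) (ltW c0) => n.
rewrite EFinM fineK// lee_pdivrMl//.
have [x _ [Ax _]|P [mP Pc AP PA wP]] := @dyadic_hull n c t r (A `&` box (B k)) c0 vc.
  exact: AM.
apply: (@le_trans _ _ (\int[leb]_(x in P) (w x)%:E)%E).
  apply: ge0_subset_integral => //; first exact: measurableI.
    exact: measurable_funS mEw.
  by move=> x [Ax Bx]; apply: AP; split => //; exact: Ac.
apply: (le_trans wP); rewrite lee_wpmul2l ?lee_fin ?(ltW r0)//.
apply: le_trans (lebesgue_outer_box _); apply: le_lebesgue_outer => x /PA[y [_ By] xy].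
move: By; rewrite /thicken; case: (B k) => [[a b]|]//= aby i.
by rewrite !mxE; have := xy i; rewrite ler_norml; have := aby i; lra.
Qed.

(** The exceptional points lie in countably many sets where all [M_n] are at most
    a rational [p] while [w] is at least a rational [q > p]. Such a set has weight
    at least [q] and at most [p] times its volume, so it is null. *)
Lemma ae_le_dyadic_max c t : 0 < c.2 -> 0 < vol c ->
  {ae leb, forall x, region c x -> forall r, 0 < r < w x ->
     exists n, r < M n c t x}.
Proof.
move=> c0 vc.
pose bad (pq : rat * rat) : set (Rd R d) :=
  [set x | region c x /\ ratr pq.2 <= w x] `&`
  \bigcap_(n in [set: nat]) [set x | M n c t x <= ratr pq.1].
pose F k := if (unpickle k : option (rat * rat)) is Some pq then
  if 0 < pq.1 < pq.2 then bad pq else set0 else set0.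
have badF p q : 0 < p < q -> (leb).-negligible (bad (p, q)).
  move=> /andP[p0 pq].
  have mbad : measurable (bad (p, q)).
    apply: measurableI.
      rewrite (_ : [set x | _ /\ _] = region c `&` [set x | ratr q <= w x])//.
      rewrite -[X in _ `&` X]setTI; apply: measurableI; first exact: measurable_region.
      rewrite (_ : [set x | _] = w @^-1` `[ratr q, +oo[); first exact: mw.
      by apply/seteqP; split=> x /=; rewrite in_itv/= andbT.
    apply: bigcapT_measurable => n; rewrite -[X in measurable X]setTI.
    rewrite (_ : [set x | _] = (M n c t) @^-1` `]-oo, ratr p]).
      exact: measurable_dyadic_max.
    by apply/seteqP; split=> x /=; rewrite in_itv.
  apply/negligibleP => //.
  have p0' : 0 < ratr p :> R by rewrite ltr0q.
  have pq' : ratr p < ratr q :> R by rewrite ltr_rat.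
  have le1 : (\int[leb]_(x in bad (p, q)) (w x)%:E <= (ratr p)%:E * leb (bad (p, q)))%E.
    apply: (@weak_type c t) => //; first by move=> x [[]].
    by move=> n x [_ /(_ n I)].
  have le2 : ((ratr q)%:E * leb (bad (p, q)) <= \int[leb]_(x in bad (p, q)) (w x)%:E)%E.
    rewrite -integral_cst//; apply: ge0_le_integral => //.
    - by move=> x _; rewrite lee_fin ltW// (lt_trans p0').
    - exact: measurable_funS mEw.
    - by move=> x [[_ qx] _]; rewrite lee_fin.
  have bad_fin : leb (bad (p, q)) \is a fin_num.
    rewrite ge0_fin_numE//; apply: (@le_lt_trans _ _ (leb (region c))).
      by apply: le_lebesgue_outer => x [[]].
    by rewrite volE ltry.
  have := le_trans le2 le1; rewrite -(fineK bad_fin) -!EFinM lee_fin.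
  have : 0 <= fine (leb (bad (p, q))) by exact/fine_ge0/lebesgue_outer_ge0.
  move=> f0 qp; rewrite -[LHS](fineK bad_fin); apply/eqP; rewrite eqe.
  rewrite eq_le f0 andbT leNgt; apply/negP => f0'; move: qp.
  by rewrite ler_pM2r// leNgt pq'.
have negF : (leb).-negligible (\bigcup_k F k).
  apply: negligible_bigcup => k; rewrite /F.
  case: (unpickle k) => [[p q]|]; last exact: negligible_set0.
  by case: ifPn => [/badF//|_]; exact: negligible_set0.
apply: (@negligibleS _ _ _ leb (\bigcup_k F k)) => //.
move=> x /not_implyP[cx] nall.
have [r [/andP[r0 rw] nM]] : exists r, 0 < r < w x /\ forall n, ~ (r < M n c t x).
  apply: contra_notP nall => nex r rw; apply: contrapT => nM; apply: nex.
  by exists r; split => // n Mn; apply: nM; exists n.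
have [q /andP[rq qw]] : exists q : rat, r < ratr q < w x.
  by have [q] := rat_in_itvoo rw; rewrite in_itv => rq; exists q.
have [q' /andP[qq' q'w]] : exists q' : rat, (ratr q : R) < ratr q' < w x.
  by have [q'] := rat_in_itvoo qw; rewrite in_itv => qq'; exists q'.
have q0 : 0 < q by rewrite -(ltr0q R) (lt_trans r0).
have qq : q < q' by rewrite -(ltr_rat R).
have qq2 : 0 < (q, q').1 < (q, q').2 by rewrite q0 qq.
exists (pickle (q, q')); first exact: I.
rewrite /F pickleK qq2; split; first by split => //; exact: ltW.
move=> n _ /=; rewrite (le_trans _ (ltW rq))// leNgt; exact/negP.
Qed.

End differentiation.

(** * The reverse Hoelder inequality *)

Section weights.
Context {R : realType} {d : nat}.
Local Notation leb := (@leb R d).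
Local Notation node := ('rV[R]_d * R)%type.
Implicit Types (c : node) (x : Rd R d) (t : R).

Lemma compact_cube (a : 'rV[R]_d) (l : R) : compact (cube a l : set 'rV[R]_d).
Proof.
rewrite (_ : cube a l = [set v : 'rV[R]_d | forall i,
    `[a 0 i, a 0 i + l]%classic (v ord0 i)]).
  apply: (@rV_compact R d (fun i => `[a 0 i, a 0 i + l]%classic)) => i.
  exact: segment_compact.
by apply/seteqP; split=> x ax i; have := ax i; rewrite /= in_itv.
Qed.

Lemma mass1 c : mass (fun=> 1) c = vol c.
Proof. by rewrite /mass integral1E//; exact: measurable_region. Qed.

Lemma integral1_fin c : (\int[leb]_(x in region c) 1 < +oo)%E.
Proof. by rewrite integral1E; [rewrite volE ltry|exact: measurable_region]. Qed.

Variable w : Rd R d -> R.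
Hypothesis hw : weight w.

Let w_ge0 x : 0 <= w x. Proof. by case: hw. Qed.
Let mw : measurable_fun setT w. Proof. by case: hw. Qed.
Let mEw : measurable_fun setT (fun x => (w x)%:E).
Proof. exact/measurable_EFinP. Qed.

Lemma wmeas_cube_fin (a : 'rV[R]_d) l : (wmeas w (cube a l) < +oo)%E.
Proof.
case: hw => _ _ /(_ _ (compact_cube (a := a) (l := l))) + _; apply: le_lt_trans.
apply: ge0_le_integral; first exact: measurable_cube.
- by move=> x _; rewrite lee_fin.
- exact: measurable_funS mEw.
- apply/measurable_EFinP; apply: measurableT_comp => //.
  exact: measurable_funS mw.
- by move=> x _; rewrite lee_fin ler_norm.
Qed.

Lemma wmeas_region c : wmeas w (cube c.1 c.2) = (\int[leb]_(x in region c) (w x)%:E)%E.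
Proof. by rewrite /wmeas integral_cube//; exact: measurable_funS mEw. Qed.

Lemma weight_region_fin c : (\int[leb]_(x in region c) (w x)%:E < +oo)%E.
Proof. by rewrite -wmeas_region wmeas_cube_fin. Qed.

Lemma wmeas_cube c : wmeas w (cube c.1 c.2) = (mass w c)%:E.
Proof. by rewrite wmeas_region massE//; exact: weight_region_fin. Qed.

Lemma avg_cube c : 0 < vol c -> avg w (cube c.1 c.2) = (mean vol (mass w) c)%:E.
Proof.
move=> vc; rewrite /avg leb_cube -/(region c) volE inver gt_eqF//.
by rewrite -/(wmeas w _) wmeas_cube -EFinM /mean mulrC.
Qed.

(** The closed cube is one of the competitors in the definition of the maximal
    function, and on it [w 1_Q] agrees with [w]. *)
Lemma mean_le_maximal c (Q : set (Rd R d)) x : 0 < c.2 -> 0 < vol c ->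
  cube c.1 c.2 `<=` Q -> region c x ->
  ((mean vol (mass w) c)%:E <= maximal (fun y => w y * \1_Q y)%R x)%E.
Proof.
move=> c0 vc cQ cx; apply: ereal_sup_ubound; exists (cube c.1 c.2).
  by split; [exists c.1, c.2|exact: hcube_subset_cube].
rewrite -avg_cube// /avg; congr (_ * _)%E; apply: eq_integral => y /set_mem cy.
by rewrite indicE mem_set ?mulr1 ?ger0_norm//; exact: cQ.
Qed.

Lemma dyadic_max_le_maximal n c t (Q : set (Rd R d)) x : 0 < c.2 -> 0 < vol c ->
  cube c.1 c.2 `<=` Q -> region c x ->
  (t%:E <= maximal (fun y => w y * \1_Q y)%R x)%E ->
  ((dyadic_max (mean vol (mass w)) n c t x)%:E <=
    maximal (fun y => w y * \1_Q y)%R x)%E.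
Proof.
elim: n c t => [|n IH] c t c0 vc cQ cx tM.
  by rewrite /= EFin_max ge_max tM mean_le_maximal.
pose s := orthant c x; have sx : region (child c s) x.
  move: (cx); rewrite {1}/region hcube_split ?(ltW c0)// -bigcup_seq.
  by case=> s' _ s'x; rewrite /s (orthant_child c0 s'x).
rewrite (dyadic_max_child _ _ _ c0 sx); apply: IH => //.
- by rewrite divr_gt0.
- by rewrite vol_child_gt0// ltW.
- by apply: subset_trans cQ; apply: cube_corner_subset; exact: ltW.
- by rewrite EFin_max ge_max tM mean_le_maximal.
Qed.

Lemma maximal_ge0 c x : 0 < c.2 -> cube c.1 c.2 x ->
  (0 <= maximal (fun y => w y * \1_(cube c.1 c.2) y)%R x)%E.
Proof.
move=> c0 cx; apply: (@le_trans _ _ (avg (fun y => `|w y * \1_(cube c.1 c.2) y|)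
   (cube c.1 c.2))); last first.
  by apply: ereal_sup_ubound; exists (cube c.1 c.2) => //; split => //; exists c.1, c.2.
apply: mule_ge0; last by apply: integral_ge0 => y _; rewrite lee_fin.
by rewrite inve_ge0 lebesgue_outer_ge0.
Qed.

Variable A : R.
Hypothesis hA : Ainfty_const w = A%:E.

Lemma integral_maximal_le c : 0 < c.2 -> 0 < mass w c ->
  (\int[leb]_(x in cube c.1 c.2) maximal (fun y => w y * \1_(cube c.1 c.2) y)%R x
   <= (A * mass w c)%:E)%E.
Proof.
move=> c0 mc; have : ((wmeas w (cube c.1 c.2))^-1 *
    \int[leb]_(x in cube c.1 c.2) maximal (fun y => w y * \1_(cube c.1 c.2) y)%R x
    <= A%:E)%E.
  rewrite -hA; apply: ereal_sup_ubound; exists (cube c.1 c.2) => //.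
  by split; [exists c.1, c.2|rewrite wmeas_cube lte_fin].
by rewrite wmeas_cube inver gt_eqF// lee_pdivrMl// -EFinM mulrC.
Qed.

(** The [A_infinity] condition for the dyadic maximal function, which the
    uncentered one dominates. *)
Lemma leaf_sum_dyadic_max_le n c : 0 < c.2 -> 0 < vol c -> 0 < mass w c ->
  leaf_sum child vol (mass w) id vol n c 0 <= A * mass w c.
Proof.
move=> c0 vc mc; rewrite -lee_fin.
have := integral_dyadic_max (fun=> ler01) (@measurable_cst _ _ _ _ _ _)
  integral1_fin vol (mass w) n (fun _ => id) (@measurable_id _ _ _) c0 (lexx 0).
rewrite (funext mass1) => <-.
apply: le_trans (integral_maximal_le c0 mc); apply: le_integral_nonmeasurable.
- exact: hcube_subset_cube.
- by move=> x _; rewrite lee_fin mulr1 dyadic_max_ge0.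
- by move=> x; exact: maximal_ge0.
- move=> x cx; rewrite mulr1; apply: dyadic_max_le_maximal => //.
  exact/(maximal_ge0 c0)/hcube_subset_cube.
Qed.

Lemma mass_gt0_vol c : 0 < mass w c -> 0 < vol c.
Proof.
move=> mc; rewrite lt0r vol_ge0 andbT; apply/eqP => v0; move: mc.
have : (\int[leb]_(x in region c) `|(w x)%:E| = 0)%E.
  apply: integral_abs_eq0; first exact: measurable_region.
  - exact: measurable_funS mEw.
  - by apply: etrans (volE c) _; rewrite v0.
under eq_integral do rewrite gee0_abs ?lee_fin//.
by rewrite /mass => ->; rewrite ltxx.
Qed.

Lemma integral_powR_eq0 c (p : R) : p != 0 -> mass w c = 0 ->
  (\int[leb]_(x in region c) (w x `^ p)%:E = 0)%E.
Proof.
move=> p0 mc0; have mc := measurable_region c.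
have mwc := measurable_funS measurableT (@subsetT _ (region c)) mEw.
have : ae_eq leb (region c) (fun x => (w x)%:E) (cst 0%E).
  apply/(ae_eq_integral_abs _ mc mwc).
  under eq_integral do rewrite gee0_abs ?lee_fin//.
  by rewrite massE ?mc0//; exact: weight_region_fin.
move=> w0; rewrite -[RHS](integral0 leb (region c)).
apply: ge0_ae_eq_integral => //.
- exact: measurable_EFin_powR.
- by move=> x _; rewrite lee_fin powR_ge0.
- by apply: filterS w0 => x wx cx; have [->] := wx cx; rewrite powR0.
Qed.

(** If [M_n] exceeds every [r < w x] for some [n], then [M_n^e w] exceeds every
    number below [w^(1+e)]. *)
Lemma powR_le_sup_dyadic_max c t e x : 0 < e -> 0 <= t ->
  (forall r, 0 < r < w x -> exists n, r < dyadic_max (mean vol (mass w)) n c t x) ->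
  ((w x `^ (1 + e))%:E <= ereal_sup (range (fun n =>
     (dyadic_max (mean vol (mass w)) n c t x `^ e * w x)%:E)))%E.
Proof.
set M := dyadic_max _ => e0 t0 wM; set s := ereal_sup _.
have Ms n : ((M n c t x `^ e * w x)%:E <= s)%E.
  by apply: ereal_sup_ubound; exists n.
rewrite leNgt; apply/negP => sw.
have s_ge0 : (0 <= s)%E.
  by apply: le_trans (Ms 0%N); rewrite lee_fin mulr_ge0// powR_ge0.
have s_fin : s \is a fin_num by rewrite ge0_fin_numE// (lt_trans sw)// ltry.
move: Ms sw s_ge0; rewrite -(fineK s_fin) lte_fin lee_fin => Ms sw s_ge0.
have w0 : 0 < w x.
  rewrite lt0r w_ge0 andbT; apply/eqP => wx0; move: sw.
  by rewrite wx0 powR0 ?gt_eqF ?addr_gt0// ltNge s_ge0.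
have [r /andP[sr rw]] : exists r, fine s < r < w x `^ (1 + e).
  by exists ((fine s + w x `^ (1 + e)) / 2); rewrite !midf_lt.
have r0 : 0 < r by exact: le_lt_trans sr.
(* s = (r / w)^(1/e) is the threshold with s^e w = r, and it lies below w *)
have rw0 : 0 < r / w x by rewrite divr_gt0.
have rwE : ((r / w x) `^ e^-1) `^ e = r / w x.
  by rewrite -powRrM mulVf ?gt_eqF// powRr1// ltW.
have [|n Mn] := wM ((r / w x) `^ e^-1).
  rewrite powR_gt0//= ltNge; apply/negP => /(le_powRl e0).
  rewrite !nnegrE rwE => /(_ (ltW w0) (powR_ge0 _ _)).
  by rewrite ler_pdivlMr// mulrC -(powR_split e0 (ltW w0)) leNgt rw.
have := Ms n; rewrite lee_fin leNgt => /negP; apply; apply: lt_le_trans sr _.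
rewrite -ler_pdivrMr// -rwE le_powRl ?nnegrE ?powR_ge0 ?dyadic_max_ge0//.
exact: ltW.
Qed.

(** Since [w <= sup_n M_n] almost everywhere, [w^(1+e)] is dominated by the
    increasing limit of [M_n^e w], whose integrals are bounded on the tree. *)
Lemma integral_powR_le c e : 0 < c.2 -> 0 < mass w c -> 0 < e -> 0 <= A ->
  2 ^+ d.+1 * A * e <= 1 + e ->
  (\int[leb]_(x in region c) (w x `^ (1 + e))%:E <=
   (2 * (mean vol (mass w) c `^ e * mass w c))%:E)%E.
Proof.
move=> c0 mc e0 A0 Ae; have vc := mass_gt0_vol mc.
set M := dyadic_max (mean vol (mass w)); set t := mean vol (mass w) c.
have t0 : 0 < t by rewrite divr_gt0.
have mpow : measurable_fun setT (fun x : R => x `^ e) by exact: measurable_powR.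
have pow0 r : 0 <= r -> 0 <= r `^ e by move=> _; exact: powR_ge0.
apply: (@integral_le_of_monotone_sup _ _ _ _ _
  (fun n x => (M n c t x `^ e * w x)%:E)).
- exact: measurable_region.
- move=> n; apply: (measurable_funS measurableT (@subsetT _ _)).
  exact: (measurable_density mw (measurable_dyadic_max _ n c t) mpow).
- by move=> n x _; rewrite lee_fin mulr_ge0// powR_ge0.
- move=> x _ n k nk; rewrite lee_fin ler_wpM2r// le_powRl ?nnegrE//.
  + by rewrite dyadic_max_ge0// ltW.
  + by rewrite dyadic_max_ge0// ltW.
  + exact: dyadic_max_homo.
- exact: measurable_EFin_powR.
- by move=> x _; rewrite lee_fin powR_ge0.
- apply: filterS (ae_le_dyadic_max w_ge0 mw weight_region_fin t c0 vc) => x xM cx.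
  by apply: powR_le_sup_dyadic_max => //; [exact: ltW|exact: xM].
move=> n; rewrite (integral_dyadic_max w_ge0 mw weight_region_fin _ _ _ pow0 mpow)
  ?(ltW t0)//.
rewrite lee_fin.
pose P c := 0 < c.2 /\ 0 < vol c :> R.
apply: (@leaf_sum_reverse_holder _ _ _ child vol (mass w) P _ _ _ _ _ (2 ^+ d)
  _ _ e e0 A) => //.
- by move=> c' s [? ?]; split; [rewrite divr_gt0|rewrite vol_child_gt0// ltW].
- by move=> c' [].
- by move=> c' _; exact: mass_ge0.
- move=> c' [c'0 _]; rewrite -(funext mass1); apply: mass_sum => //.
  exact: integral1_fin.
- by move=> c' [c'0 _]; apply: mass_sum => //; exact: weight_region_fin.
- by move=> c' s [c'0 _]; rewrite -vol_child// ltW.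
- by rewrite exprn_ege1// ler1n.
- move=> k c' [c'0 vc'] m'; apply: leaf_sum_dyadic_max_le => //.
  by move: m'; rewrite /mean pmulr_lgt0// invr_gt0.
- by rewrite exprS in Ae.
Qed.

End weights.

Theorem theorem2p3 (R : realType) (d : nat) (hd : (0 < d)%N)
    (w : Rd R d -> R) (hw : Ainfty w)
    (Q0 : set (Rd R d)) (hQ0 : is_cube Q0)
    (eps : R) (eps_gt0 : 0 < eps)
    (eps_le : eps <= 1 / (2 ^+ d.+1 * fine (Ainfty_const w) - 1)) :
  (avg (fun x => (w x `^ (1 + eps))%R) Q0 <= 2%:E * avg w Q0 `^ (1 + eps))%E.
Proof.
case: hw => hw A_fin; case: hQ0 => a [l [l0 ->]].
have [w_ge0 mw _ _] := hw.
pose c : 'rV[R]_d * R := (a, l).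
have e1 : 0 < 1 + eps by rewrite addr_gt0.
have intE : (\int[leb]_(x in cube a l) (w x `^ (1 + eps))%:E =
    \int[leb]_(x in region c) (w x `^ (1 + eps))%:E)%E.
  apply: integral_cube; last by move=> x; rewrite lee_fin powR_ge0.
  exact: measurable_EFin_powR.
have [m0|m0] := eqVneq (mass w c) 0.
  rewrite {1}/avg intE integral_powR_eq0 ?gt_eqF// mule0 mule_ge0 ?lee_fin//.
  exact: poweR_ge0.
have mc : 0 < mass w c by rewrite lt0r m0 mass_ge0.
have vc : 0 < vol c by exact: mass_gt0_vol mc.
have A_ge0 : (0 <= Ainfty_const w)%E.
  apply: (@le_trans _ _ ((wmeas w (cube a l))^-1 * \int[leb]_(x in cube a l)
      maximal (fun y => w y * \1_(cube a l) y)%R x)%E).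
    apply: mule_ge0; last by apply: integral_ge0 => x; exact: (maximal_ge0 w (c := c)).
    by rewrite inve_ge0 integral_ge0// => x _; rewrite lee_fin.
  apply: ereal_sup_ubound; exists (cube a l) => //; split; first by exists a, l.
  by rewrite (wmeas_cube hw c) lte_fin.
have A_num : Ainfty_const w \is a fin_num by rewrite ge0_fin_numE.
have hA := esym (fineK A_num); set A := fine (Ainfty_const w) in hA eps_le.
have A0 : 0 <= A by exact: fine_ge0.
(* a positive [eps] forces a positive denominator in the bound on [eps] *)
have AK : 0 < 2 ^+ d.+1 * A - 1.
  by rewrite -invr_gt0 -[_^-1]mul1r (lt_le_trans eps_gt0).
have Ae : 2 ^+ d.+1 * A * eps <= 1 + eps.
  by move: eps_le; rewrite ler_pdivlMr//; lra.
rewrite (avg_cube hw (c := c) vc) poweR_EFin.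
rewrite /avg intE leb_cube -/(region c) volE inver gt_eqF//.
rewrite lee_pdivrMl//.
apply: le_trans (integral_powR_le hw hA (c := c) l0 mc eps_gt0 A0 Ae) _.
rewrite -!EFinM lee_fin powR_split//; last by rewrite divr_ge0// ltW.
set m := mean vol (mass w) c.
have -> : mass w c = vol c * m by rewrite /m /mean mulrC divfK// gt_eqF.
by rewrite le_eqVlt; apply/orP; left; apply/eqP; ring.
Qed.
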